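(* Let $\mathbf F$ be a non-abelian free group, freely generated by a set $S$, equipped with the bi-invariant word metric $d_{\overline{S}}$ associated with $S$. Then for every non-principal ultrafilter $\omega$ on the set of positive integers, the group $\mathrm{Cone}_{\omega}(\mathbf F,d_{\overline{S}})$ contains non-trivial elements of order $2$.
   Context: Let $\overline{S}=\bigcup_{g\in\mathbf F} g^{-1}S^{\pm1}g$ be the union of the conjugacy classes of all generators $s\in S$ and their inverses. For $g\in\mathbf F$ let $\|g\|$ be the smallest integer $m\ge 0$ such that $g$ is a product of $m$ elements of $\overline{S}$. The bi-invariant word metric is $d_{\overline{S}}(g,h)=\|g^{-1}h\|$. Asymptotic cone: given a metric space $(X,d)$ and a non-principal ultrafilter $\omega$ on the positive integers, consider the set of sequences $(x_n)_{n\ge1}$ in $X$ for which $\{d(x_n,x_1)/n : n\ge 1\}$ is bounded, with the pseudo-metric $d_\omega((x_n),(y_n))=\lim_\omega \frac{d(x_n,y_n)}{n}$ (ultralimit along $\omega$). $\mathrm{Cone}_\omega(X,d)$ is the set of equivalence classes for the relation $(x_n)\sim(y_n)\iff d_\omega((x_n),(y_n))=0$, with the induced metric. When $X=G$ is a group and $d$ is bi-invariant (i.e. $d(fg,fh)=d(gf,hf)=d(g,h)$ for all $f,g,h\in G$), $\mathrm{Cone}_\omega(G,d)$ is a group with multiplication $[g_n]\cdot[h_n]=[g_nh_n]$; distances to the identity may equivalently be used in place of $d(x_n,x_1)$. *)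

(* Defs.v *)
From HB Require Import structures.
From mathcomp Require Import all_boot all_order all_algebra.
From mathcomp Require Import all_classical all_reals all_analysis.
Set Implicit Arguments.
Unset Strict Implicit.
Unset Printing Implicit Defensive.
Import Order.TTheory GRing.Theory Num.Theory.
Import numFieldNormedType.Exports.
Local Open Scope classical_set_scope.
Local Open Scope ring_scope.
Local Open Scope quotient_scope.

Definition posint := {n : nat | (0 < n)%N}.

Definition posint1 : posint := exist _ 1%N isT.

HB.mixin Record isBiInvariant (R : realType) G & Group G & Metric R G := {
  mdist_mulg2l : forall f g h : G, mdist (f * g)%g (f * h)%g = mdist g h ;
  mdist_mulg2r : forall f g h : G, mdist (g * f)%g (h * f)%g = mdist g h
}.

#[short(type="biInvMetricGroupType")]
HB.structure Definition BiInvMetricGroup (R : realType) :=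
  { G of Group G & Metric R G & isBiInvariant R G }.

Section Cone.
Context (R : realType) (w : set_system posint) (Uw : UltraFilter w).

Section ConeMetric.
Context (X : metricType R).

Definition linear_growth (x : posint -> X) : Prop :=
  exists C : R, forall n, mdist (x n) (x posint1) / (val n)%:R <= C.

Record cone_seq := ConeSeq {
  cone_seq_val :> posint -> X ;
  cone_seqP : `[< linear_growth cone_seq_val >] }.

HB.instance Definition _ := [isSub for cone_seq_val].
HB.instance Definition _ := gen_eqMixin cone_seq.
HB.instance Definition _ := gen_choiceMixin cone_seq.

(* The limit along the ultrafilter exists on cone_seq: is_cvg_cone_pdist. *)
Definition cone_pdist (x y : posint -> X) : R :=
  lim (mdist (x n) (y n) / (val n)%:R @[n --> w]).

Lemma posint_gt0 (n : posint) : 0 < (val n)%:R :> R.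
Proof. by rewrite ltr0n; exact: valP. Qed.

Lemma is_cvg_ultra_bounded (f : posint -> R) (C : R) :
  (forall n, 0 <= f n <= C) -> cvg (f n @[n --> w]).
Proof.
move=> fC; have := @segment_compact R 0 C.
rewrite compact_ultra => /(_ (f @ w) _ _)[].
- split => [|G PG wG]; first exact: fmap_proper_filter.
  apply/seteqP; split=> [A GA|]; last exact: wG.
  have [//|wA] := in_ultra_setVsetC (f @^-1` A) Uw.
  have : G set0 by rewrite -(setICr A); apply: filterI => //; exact: wG.
  by move/filter_not_empty.
- by apply: (@filterE _ w _ (f @^-1` _)) => n; rewrite /= in_itv/=.
- by move=> l [_ fl]; apply/cvg_ex; exists l.
Qed.

Lemma ultralim_leD (f g h : posint -> R) :
  cvg (f n @[n --> w]) -> cvg (g n @[n --> w]) -> cvg (h n @[n --> w]) ->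
  (forall n, f n <= g n + h n) ->
  lim (f n @[n --> w]) <= lim (g n @[n --> w]) + lim (h n @[n --> w]).
Proof.
move=> cf cg ch fgh; rewrite -limD// -subr_ge0 -limB//; last exact: is_cvgD.
apply: limr_ge; first by apply: is_cvgB => //; exact: is_cvgD.
by apply: filterE => n; rewrite subr_ge0; exact: fgh.
Qed.

Lemma cone_seq_bound (x y : cone_seq) :
  exists C : R, forall n, 0 <= mdist (x n) (y n) / (val n)%:R <= C.
Proof.
have [[C xC] [D yD]] : linear_growth x /\ linear_growth y.
  by split; apply/asboolP; exact: cone_seqP.
exists (C + mdist (x posint1) (y posint1) + D) => n.
have n0 := posint_gt0 n.
have dn0 : 0 <= mdist (x n) (y n) / (val n)%:R.
  by rewrite divr_ge0 ?mdist_ge0 ?ler0n.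
rewrite dn0 /= ler_pdivrMr//.
move: (xC n) (yD n); rewrite !ler_pdivrMr// => xCn yDn.
apply: le_trans (metric_triangle _ (x posint1) _) _.
rewrite -addrA mulrDl lerD//.
apply: le_trans (metric_triangle _ (y posint1) _) _.
rewrite mulrDl lerD//; last by rewrite metric_sym.
by rewrite ler_peMr ?mdist_ge0// ler1n; exact: valP.
Qed.

Lemma is_cvg_cone_pdist (x y : cone_seq) :
  cvg (mdist (x n) (y n) / (val n)%:R @[n --> w]).
Proof.
have [C xyC] := cone_seq_bound x y.
exact: is_cvg_ultra_bounded xyC.
Qed.

Lemma cone_pdist_ge0 (x y : cone_seq) : 0 <= cone_pdist x y.
Proof.
apply: limr_ge; first exact: is_cvg_cone_pdist.
by apply: filterE => n; rewrite divr_ge0 ?mdist_ge0.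
Qed.

Lemma cone_pdistxx (x : posint -> X) : cone_pdist x x = 0.
Proof.
rewrite /cone_pdist; under eq_fun do rewrite mdistxx mul0r.
exact: lim_cst.
Qed.

Lemma cone_pdist_sym (x y : posint -> X) : cone_pdist x y = cone_pdist y x.
Proof. by rewrite /cone_pdist; under eq_fun do rewrite metric_sym. Qed.

Lemma cone_pdist_triangle (x y z : cone_seq) :
  cone_pdist x z <= cone_pdist x y + cone_pdist y z.
Proof.
apply: ultralim_leD => [|||n]; [exact: is_cvg_cone_pdist..|].
rewrite -mulrDl ler_pM2r ?invr_gt0 ?posint_gt0//.
exact: metric_triangle.
Qed.

Definition cone_equiv (x y : cone_seq) : bool := cone_pdist x y == 0.

Lemma cone_equiv_refl : reflexive cone_equiv.
Proof. by move=> x; rewrite /cone_equiv cone_pdistxx. Qed.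

Lemma cone_equiv_sym : symmetric cone_equiv.
Proof. by move=> x y; rewrite /cone_equiv cone_pdist_sym. Qed.

Lemma cone_equiv_trans : transitive cone_equiv.
Proof.
move=> y x z /eqP xy /eqP yz; rewrite /cone_equiv eq_le cone_pdist_ge0 andbT.
by rewrite (le_trans (cone_pdist_triangle x y z))// xy yz addr0.
Qed.

Canonical cone_equiv_rel :=
  EquivRel cone_equiv cone_equiv_refl cone_equiv_sym cone_equiv_trans.

Definition Cone := {eq_quot cone_equiv}.
HB.instance Definition _ := Choice.on Cone.
HB.instance Definition _ := EqQuotient.on Cone.

Definition cone_class (x : cone_seq) : Cone := \pi_Cone x.

Lemma cone_classE (x y : cone_seq) :
  cone_class x = cone_class y <-> cone_pdist x y = 0.
Proof. by split=> [/eqmodP/eqP|xy]; last by apply/eqmodP/eqP. Qed.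

Lemma cone_classK (a : Cone) : cone_class (repr a) = a.
Proof. exact: reprK. Qed.

Definition cone_dist (a b : Cone) : R := cone_pdist (repr a) (repr b).

Lemma cone_dist_class (x y : cone_seq) :
  cone_dist (cone_class x) (cone_class y) = cone_pdist x y.
Proof.
have E (z : cone_seq) : cone_pdist z (repr (cone_class z)) = 0.
  by apply/cone_classE; rewrite cone_classK.
have E' (z : cone_seq) : cone_pdist (repr (cone_class z)) z = 0.
  by rewrite cone_pdist_sym.
rewrite /cone_dist; apply/eqP; rewrite eq_le; apply/andP; split.
  rewrite (le_trans (cone_pdist_triangle _ x _))// E' add0r.
  by rewrite (le_trans (cone_pdist_triangle _ y _))// E addr0.
rewrite (le_trans (cone_pdist_triangle _ (repr (cone_class x)) _))// E add0r.
rewrite (le_trans (cone_pdist_triangle _ (repr (cone_class y)) _))//.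
by rewrite E' addr0.
Qed.

Lemma cone_distxx a : cone_dist a a = 0.
Proof. exact: cone_pdistxx. Qed.

Lemma cone_dist_positivity a b : cone_dist a b = 0 -> a = b.
Proof. by move/cone_classE; rewrite !cone_classK. Qed.

Lemma cone_dist_sym a b : cone_dist a b = cone_dist b a.
Proof. exact: cone_pdist_sym. Qed.

Lemma cone_dist_triangle b a c : cone_dist a c <= cone_dist a b + cone_dist b c.
Proof. exact: cone_pdist_triangle. Qed.

HB.instance Definition _ := @isMetric.Build R Cone cone_dist
  cone_distxx cone_dist_positivity cone_dist_sym cone_dist_triangle.

End ConeMetric.

Section ConeGroup.
Context (G : biInvMetricGroupType R).
Implicit Types x y z : cone_seq G.

Lemma mdist_mulgg (a b c d : G) :
  mdist (a * b)%g (c * d)%g <= mdist a c + mdist b d.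
Proof.
by rewrite (le_trans (metric_triangle _ (c * b)%g _))//
  mdist_mulg2l mdist_mulg2r.
Qed.

Lemma mdist_invg (a b : G) : mdist a^-1%g b^-1%g = mdist a b.
Proof.
rewrite -(mdist_mulg2l a) mulgV -(mdist_mulg2r b) mul1g -mulgA mulVg mulg1.
exact: metric_sym.
Qed.

Lemma linear_growth1 : `[< linear_growth (fun=> 1%g : G) >].
Proof. by apply/asboolP; exists 0 => n; rewrite mdistxx mul0r. Qed.

Lemma linear_growthV x : `[< linear_growth (fun n => (x n)^-1%g) >].
Proof.
have /asboolP[C xC] := cone_seqP x.
by apply/asboolP; exists C => n; rewrite mdist_invg.
Qed.

Lemma linear_growthM x y : `[< linear_growth (fun n => x n * y n)%g >].
Proof.
have [/asboolP[C xC] /asboolP[D yD]] := (cone_seqP x, cone_seqP y).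
apply/asboolP; exists (C + D) => n; rewrite (le_trans _ (lerD (xC n) (yD n)))//.
by rewrite -mulrDl ler_pM2r ?invr_gt0 ?posint_gt0// mdist_mulgg.
Qed.

Definition cone_seq1 := ConeSeq linear_growth1.
Definition cone_seqV x := ConeSeq (linear_growthV x).
Definition cone_seqM x y := ConeSeq (linear_growthM x y).

Definition cone1 : Cone G := cone_class cone_seq1.
Definition coneV (a : Cone G) : Cone G := cone_class (cone_seqV (repr a)).
Definition coneM (a b : Cone G) : Cone G :=
  cone_class (cone_seqM (repr a) (repr b)).

Lemma coneM_class x y :
  coneM (cone_class x) (cone_class y) = cone_class (cone_seqM x y).
Proof.
apply/cone_classE; apply/eqP; rewrite eq_le cone_pdist_ge0 andbT.
have E (z : cone_seq G) : cone_pdist (repr (cone_class z)) z = 0.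
  by apply/cone_classE; rewrite cone_classK.
rewrite -[leRHS](addr0 0) -{1}(E x) -(E y).
apply: ultralim_leD => [|||n]; [exact: is_cvg_cone_pdist..|].
rewrite -mulrDl ler_pM2r ?invr_gt0 ?posint_gt0//.
exact: mdist_mulgg.
Qed.

Lemma coneV_class x : coneV (cone_class x) = cone_class (cone_seqV x).
Proof.
apply/cone_classE; rewrite /cone_pdist; under eq_fun do rewrite mdist_invg.
by apply/cone_classE; rewrite cone_classK.
Qed.

Lemma eq_cone_class x y : x =1 y -> cone_class x = cone_class y.
Proof. by move=> xy; congr cone_class; apply/val_inj/funext. Qed.

Lemma coneMA : associative coneM.
Proof.
move=> a b c; rewrite -(cone_classK a) -(cone_classK b) -(cone_classK c).
by rewrite !coneM_class; apply: eq_cone_class => n /=; rewrite mulgA.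
Qed.

Lemma cone1M : left_id cone1 coneM.
Proof.
move=> a; rewrite -(cone_classK a) coneM_class.
by apply: eq_cone_class => n /=; rewrite mul1g.
Qed.

Lemma coneM1 : right_id cone1 coneM.
Proof.
move=> a; rewrite -(cone_classK a) coneM_class.
by apply: eq_cone_class => n /=; rewrite mulg1.
Qed.

Lemma coneVM : left_inverse cone1 coneV coneM.
Proof.
move=> a; rewrite -(cone_classK a) coneV_class coneM_class.
by apply: eq_cone_class => n /=; rewrite mulVg.
Qed.

Lemma coneMV : right_inverse cone1 coneV coneM.
Proof.
move=> a; rewrite -(cone_classK a) coneV_class coneM_class.
by apply: eq_cone_class => n /=; rewrite mulgV.
Qed.

HB.instance Definition _ :=
  isGroup.Build (Cone G) coneMA cone1M coneM1 coneVM coneMV.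

End ConeGroup.
End Cone.

Arguments Cone {R w} Uw X.

Section WordMetric.
Context (F : groupType) (S : set F).

(* The universal property of the free group on S; between groups, a
   multiplicative map is a group morphism. *)
Definition freely_generated : Prop :=
  forall (H : groupType) (f : S -> H),
    (exists phi : {multiplicative F -> H}, forall s : S, phi (val s) = f s) /\
    (forall phi psi : {multiplicative F -> H},
      (forall s : S, phi (val s) = psi (val s)) -> phi =1 psi).

Definition conj_gens : set F :=
  \bigcup_(g in [set: F])
    [set (s ^ g)%g | s in S `|` [set (s^-1)%g | s in S]].

Definition is_word_product (g : F) (m : nat) : bool :=
  `[< exists2 t : 'I_m -> F, forall i, conj_gens (t i) &
      g = (\prod_(i < m) t i)%g >].

Definition word_span : {pred F} :=
  fun g => `[< exists m, is_word_product g m >].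

Lemma is_word_product0 g : is_word_product g 0 = (g == 1%g).
Proof.
apply/asboolP/eqP => [[t _ ->]|->]; first by rewrite big_ord0.
by exists (fun=> 1%g); [case|rewrite big_ord0].
Qed.

Lemma conj_gensP h : conj_gens h <->
  exists s g, S s /\ (h = (s ^ g)%g \/ h = (s^-1 ^ g)%g).
Proof.
split=> [[g _ [x [Sx|[s Ss <-]] <-]]|[s [g [Ss [->|->]]]]].
- by exists x, g; split; [|left].
- by exists s, g; split; [|right].
- by exists g => //; exists s => //; left.
- by exists g => //; exists (s^-1)%g => //; right; exists s.
Qed.

Lemma conj_gensV h : conj_gens h -> conj_gens h^-1%g.
Proof.
move=> /conj_gensP[s [g [Ss h_]]]; apply/conj_gensP; exists s, g; split=> //.
by case: h_ => ->; rewrite -conjVg ?invgK; [right|left].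
Qed.

Lemma conj_gensJ h k : conj_gens h -> conj_gens (h ^ k)%g.
Proof.
move=> /conj_gensP[s [g [Ss h_]]]; apply/conj_gensP; exists s, (g * k)%g.
by split=> //; case: h_ => ->; rewrite -conjgM; [left|right].
Qed.

Lemma is_word_product1 h : conj_gens h -> is_word_product h 1.
Proof.
move=> Sh; apply/asboolP; exists (fun=> h) => //.
by rewrite big_ord_recl big_ord0 mulg1.
Qed.

Lemma is_word_productM g h m n : is_word_product g m -> is_word_product h n ->
  is_word_product (g * h)%g (m + n).
Proof.
move=> /asboolP[t St ->] /asboolP[u Su ->]; apply/asboolP.
exists (fun i : 'I_(m + n) =>
  match fintype.split i with inl j => t j | inr j => u j end).
  by move=> i; case: splitP.
rewrite big_split_ord /=; congr (_ * _)%g; apply: eq_bigr => i _.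
  by rewrite -/(lshift n i) (unsplitK (inl i)).
by rewrite -/(rshift m i) (unsplitK (inr i)).
Qed.

Lemma is_word_productV g m : is_word_product g m -> is_word_product g^-1%g m.
Proof.
elim: m g => [|m IHm] g.
  by rewrite !is_word_product0 => /eqP->; rewrite invg1.
move=> /asboolP[t St ->]; rewrite big_ord_recl invgM.
suff : is_word_product ((\prod_(i < m) t (lift ord0 i))^-1 / t ord0)%g (m + 1).
  by rewrite addn1.
apply: is_word_productM; last exact/is_word_product1/conj_gensV.
by apply: IHm; apply/asboolP; exists (fun i => t (lift ord0 i)).
Qed.

Lemma is_word_productJ g k m :
  is_word_product g m -> is_word_product (g ^ k)%g m.
Proof.
elim: m g => [|m IHm] g.
  by rewrite !is_word_product0 => /eqP->; rewrite conj1g.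
move=> /asboolP[t St ->]; rewrite big_ord_recl conjMg.
apply: (@is_word_productM _ _ 1 m); first exact/is_word_product1/conj_gensJ.
by apply: IHm; apply/asboolP; exists (fun i => t (lift ord0 i)).
Qed.

Lemma word_span_group_closed : group_closed word_span.
Proof.
split=> [|g h].
  by apply/asboolP; exists 0; rewrite is_word_product0.
move=> /asboolP[m gm] /asboolP[n hn]; apply/asboolP; exists (m + n).
by apply: is_word_productM => //; exact: is_word_productV.
Qed.

Definition word_span_group := {g : F | word_span g}.
HB.instance Definition _ := SubChoice.on word_span_group.
HB.instance Definition _ :=
  SubChoice_isSubGroup.Build F word_span word_span_group word_span_group_closed.

Context (freeS : freely_generated).

Lemma freely_generated_span g : exists m, is_word_product g m.
Proof.
have gensS (s : S) : word_span (val s).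
  apply/asboolP; exists 1; apply: is_word_product1; apply/conj_gensP.
  by exists (val s), 1%g; split; [exact: set_valP|left; rewrite conjg1].
have [[phi phiS] _] :=
  freeS (fun s => exist _ (val s) (gensS s) : word_span_group).
have valM : {morph (val : word_span_group -> F) : x y / (x * y)%g} by [].
pose v : {multiplicative word_span_group -> F} := HB.pack
  (val : word_span_group -> F)
  (isMultiplicative.Build word_span_group F val valM).
have [_ /(_ (v \o phi) idfun) vphi] := freeS (fun s => val s).
have <- : val (phi g) = g by apply: vphi => s /=; rewrite phiS.
exact/asboolP/(valP (phi g)).
Qed.

Definition word_norm (g : F) : nat := ex_minn (freely_generated_span g).

Lemma word_norm_product g : is_word_product g (word_norm g).
Proof. by rewrite /word_norm; case: ex_minnP. Qed.

Lemma word_norm_le g m : is_word_product g m -> (word_norm g <= m)%N.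
Proof. by rewrite /word_norm; case: ex_minnP => k _; exact. Qed.

Lemma word_norm_eq0 g : (word_norm g == 0%N) = (g == 1%g).
Proof.
apply/idP/idP => [/eqP g0|]; rewrite -is_word_product0.
  by rewrite -g0 word_norm_product.
by move/word_norm_le; rewrite leqn0.
Qed.

Lemma word_normM g h : (word_norm (g * h)%g <= word_norm g + word_norm h)%N.
Proof.
by apply: word_norm_le; apply: is_word_productM; exact: word_norm_product.
Qed.

Lemma word_normV g : word_norm g^-1%g = word_norm g.
Proof.
wlog suff le : g / (word_norm g^-1%g <= word_norm g)%N.
  by apply/eqP; rewrite eqn_leq le -{1}[g]invgK le.
exact/word_norm_le/is_word_productV/word_norm_product.
Qed.

Lemma word_normJ g k : word_norm (g ^ k)%g = word_norm g.
Proof.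
wlog suff le : g k / (word_norm (g ^ k)%g <= word_norm g)%N.
  by apply/eqP; rewrite eqn_leq le -{1}[g](conjgK k) le.
exact/word_norm_le/is_word_productJ/word_norm_product.
Qed.

Context (R : realType).

Definition word_dist (g h : F) : R := (word_norm (g^-1 * h)%g)%:R.

Lemma word_distxx g : word_dist g g = 0.
Proof.
by apply/eqP; rewrite pnatr_eq0 word_norm_eq0 mulVg.
Qed.

Lemma word_dist_positivity g h : word_dist g h = 0 -> g = h.
Proof.
move/eqP; rewrite pnatr_eq0 word_norm_eq0 => /eqP gh.
by rewrite -[LHS]mulg1 -gh mulgA mulgV mul1g.
Qed.

Lemma word_dist_sym g h : word_dist g h = word_dist h g.
Proof. by rewrite /word_dist -word_normV invgM invgK. Qed.

Lemma word_dist_triangle h g k :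
  word_dist g k <= word_dist g h + word_dist h k.
Proof.
rewrite /word_dist -natrD ler_nat (leq_trans _ (word_normM _ _))//.
by rewrite mulgA -(mulgA _ h) mulgV mulg1.
Qed.

Lemma word_dist_mulg2l f g h : word_dist (f * g)%g (f * h)%g = word_dist g h.
Proof. by rewrite /word_dist invgM -mulgA (mulgA f^-1%g) mulVg mul1g. Qed.

Lemma word_dist_mulg2r f g h : word_dist (g * f)%g (h * f)%g = word_dist g h.
Proof.
by rewrite /word_dist -[in RHS](word_normJ _ f) invgM /conjg !mulgA.
Qed.

(* An alias of F, so that the metric can depend on S (through freeS) and R. *)
Definition word_metric_group (_ : freely_generated) (_ : realType) : Type := F.
HB.instance Definition _ := Group.on (word_metric_group freeS R).
HB.instance Definition _ := @isMetric.Build R (word_metric_group freeS R)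
  word_dist word_distxx word_dist_positivity word_dist_sym word_dist_triangle.
HB.instance Definition _ := @isBiInvariant.Build R (word_metric_group freeS R)
  word_dist_mulg2l word_dist_mulg2r.

End WordMetric.

Arguments freely_generated {F} S.
Arguments word_metric_group {F S} _ _.

(* Main.v *)
From HB Require Import structures.
Require Import Defs.
From mathcomp Require Import all_boot all_order all_algebra.
From mathcomp Require Import all_classical all_reals all_analysis.
From mathcomp Require Import ring lra.
Set Implicit Arguments.
Unset Strict Implicit.
Unset Printing Implicit Defensive.
Import Order.TTheory GRing.Theory Num.Theory.
Import numFieldNormedType.Exports.
Local Open Scope classical_set_scope.
Local Open Scope ring_scope.

(** It suffices to find, for every N, an element g of F with norm exactly N and
    with g * g of norm at most 4 ([exists_norm_small_square]): such elements
    g_1, g_2, ... define a point of the cone at distance 1 from the identity,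
    and its square is trivial because 4 / n tends to 0 along a non-principal
    ultrafilter.

    The elements come from a surface.  An equation g^2 = x1 x2 x3 x4, where each
    x_i is conjugate to a generator or to the inverse of one, says that g is the
    core of a projective plane with four holes whose boundaries are labelled by
    the x_i.  Mapping classes of this surface produce new solutions from old
    ones.  The one used here, [push], is the n-th power of the twist that
    conjugates x1 and x2 by c = x1 x2, followed by pushing the first hole
    through the crosscap: it replaces g by y^-1 g, where y is the conjugate of
    x1 by c^n.  Here x3 x4 = (a b)^-1 never changes, for two generators a and b,
    so that c = g^2 a b.  All squares have norm at most 4, and the norm of g
    grows by at most one at each step, so it only remains to see that the norms
    are unbounded: intermediate values are then attained.

    The lower bound comes from orthogonal representations.  For an orthogonal
    matrix U of size m, the displacement m - tr U is half of the squared
    Hilbert-Schmidt norm of U - 1; it is invariant under conjugation, and a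
    product of k matrices of displacement at most C has displacement at most
    k^2 C ([displacement_prod]).  Now choose a small rotation t whose n-th power
    moves a vector v through pairwise orthogonal positions v_0, v_1, ..., v_K
    ([exists_small_shift]), and send a to the reflection in v_0 and a b to t.
    Both generators have displacement at most 6, whatever K is.  In this
    representation each push composes g with the reflection in the next v_i: the
    reflections involved commute, so g is an involution, c is mapped to t at
    every stage, and y is mapped to the next reflection.  After K pushes the
    displacement of g is 2 K, whence 2 K <= 6 (norm g)^2. *)

(** * Orthogonal matrices and their displacement *)

Section OrthogonalGroup.
Context (R : realFieldType) (m : nat).

Record orthogonal_mx := Orthogonal {
  omat :> 'M[R]_m ;
  omatP : omat *m omat^T == 1%:M }.

HB.instance Definition _ := [isSub for omat].
HB.instance Definition _ := [Choice of orthogonal_mx by <:].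

Lemma omatK (U : orthogonal_mx) : U *m U^T = 1%:M.
Proof. exact/eqP/omatP. Qed.

Lemma omatKT (U : orthogonal_mx) : U^T *m U = 1%:M.
Proof. exact/mulmx1C/omatK. Qed.

Fact orthogonal1_subproof : (1%:M : 'M[R]_m) *m 1%:M^T == 1%:M.
Proof. by rewrite trmx1 mulmx1. Qed.

Fact orthogonalV_subproof (U : orthogonal_mx) : U^T *m U^T^T == 1%:M.
Proof. by rewrite trmxK omatKT. Qed.

Fact orthogonalM_subproof (U V : orthogonal_mx) :
  (U *m V) *m (U *m V)^T == 1%:M.
Proof.
by rewrite trmx_mul mulmxA -(mulmxA (omat U)) omatK mulmx1 omatK.
Qed.

Definition orthogonal1 := Orthogonal orthogonal1_subproof.
Definition orthogonalV U := Orthogonal (orthogonalV_subproof U).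
Definition orthogonalM U V := Orthogonal (orthogonalM_subproof U V).

Fact orthogonal_mulA : associative orthogonalM.
Proof. by move=> U V W; apply: val_inj; rewrite /= mulmxA. Qed.

Fact orthogonal_mul1 : left_id orthogonal1 orthogonalM.
Proof. by move=> U; apply: val_inj; rewrite /= mul1mx. Qed.

Fact orthogonal_mulr1 : right_id orthogonal1 orthogonalM.
Proof. by move=> U; apply: val_inj; rewrite /= mulmx1. Qed.

Fact orthogonal_mulV : left_inverse orthogonal1 orthogonalV orthogonalM.
Proof. by move=> U; apply: val_inj; exact: omatKT. Qed.

Fact orthogonal_mulrV : right_inverse orthogonal1 orthogonalV orthogonalM.
Proof. by move=> U; apply: val_inj; exact: omatK. Qed.

HB.instance Definition _ := isGroup.Build orthogonal_mx
  orthogonal_mulA orthogonal_mul1 orthogonal_mulr1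
  orthogonal_mulV orthogonal_mulrV.

Lemma omat_inj : injective omat. Proof. exact: val_inj. Qed.

Lemma omat1 : omat 1%g = 1%:M. Proof. by []. Qed.

Lemma omatV (U : orthogonal_mx) : omat U^-1%g = U^T. Proof. by []. Qed.

Lemma omatM (U V : orthogonal_mx) : omat (U * V)%g = U *m V. Proof. by []. Qed.

Definition frob (A : 'M[R]_m) : R := \tr (A *m A^T).

Lemma frob_ge0 A : 0 <= frob A.
Proof.
apply: sumr_ge0 => i _; rewrite mxE; apply: sumr_ge0 => j _.
by rewrite mxE -expr2 sqr_ge0.
Qed.

(** Completing the square in this form, with a free weight k, replaces the
    triangle inequality for the Hilbert-Schmidt norm and avoids square roots. *)
Lemma frobDB (k : R) (A B : 'M[R]_m) :
  k * frob (A + B) + frob (A - k *: B) =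
  (k + 1) * frob A + k * (k + 1) * frob B.
Proof.
have trD : (A + B)^T = A^T + B^T by exact: linearD.
have trB : (A - k *: B)^T = A^T - k *: B^T by rewrite linearB linearZ.
rewrite /frob trD trB mulmxBl !mulmxBr mulmxDl !mulmxDr.
rewrite -!scalemxAl -!scalemxAr !(mxtraceD, raddfN) /=.
rewrite !(mxtraceD, raddfN) /= !mxtraceZ.
have -> : \tr (B *m A^T) = \tr (A *m B^T).
  by rewrite -mxtrace_tr trmx_mul trmxK.
ring.
Qed.

(** Half of the squared Hilbert-Schmidt norm of U - 1: see [frob_sub1]. *)
Definition displacement (U : orthogonal_mx) : R := m%:R - \tr U.

Lemma frob_sub1 (U : orthogonal_mx) : frob (omat U - 1%:M) = 2 * displacement U.
Proof.
rewrite /frob /displacement linearB /= trmx1.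
rewrite mulmxBl !mulmxBr omatK !mulmx1 mul1mx !linearB /=.
rewrite mxtrace_tr mxtrace1; ring.
Qed.

Lemma displacementV U : displacement U^-1%g = displacement U.
Proof. by rewrite /displacement omatV mxtrace_tr. Qed.

Lemma displacementJ U V : displacement (U ^ V)%g = displacement U.
Proof.
by rewrite /displacement conjgE !omatM mxtrace_mulC -mulmxA omatV omatK mulmx1.
Qed.

(** The square root of the displacement is subadditive, since
    UV - 1 = (U - 1) + U (V - 1).  This weighted consequence is the form that
    an induction on the number of factors needs: for positive k, if the
    displacement of U is at most k^2 C and that of V at most C, then that of UV
    is at most (k + 1)^2 C. *)
Lemma displacementM (k : nat) (U V : orthogonal_mx) :
  k%:R * displacement (U * V)%g <=
  k.+1%:R * displacement U + k%:R * k.+1%:R * displacement V.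
Proof.
set A := omat U - 1%:M; set B := omat U *m (omat V - 1%:M).
have fB : frob B = 2 * displacement V.
  rewrite -frob_sub1 /frob /B trmx_mul mulmxA mxtrace_mulC.
  by rewrite !mulmxA omatKT mul1mx.
have AB : omat (U * V)%g - 1%:M = A + B.
  by rewrite omatM /A /B mulmxBr mulmx1 [RHS]addrC addrA subrK.
have := frobDB k%:R A B; rewrite -AB fB !frob_sub1 natr1.
have := frob_ge0 (A - k%:R *: B); lra.
Qed.

Lemma displacement_prod (C : R) (k : nat) (U : 'I_k -> orthogonal_mx) :
  (forall i, displacement (U i) <= C) ->
  displacement (\prod_(i < k) U i)%g <= k%:R ^+ 2 * C.
Proof.
elim: k U => [|k IHk] U UC.
  by rewrite big_ord0 /displacement omat1 mxtrace1 subrr expr0n mul0r.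
case: k => [|k] in U UC IHk *.
  by rewrite big_ord_recl big_ord0 mulg1 expr1n mul1r.
rewrite big_ord_recr /=.
have /IHk {}IHk : forall i, displacement (U (widen_ord (leqnSn k.+1) i)) <= C.
  by move=> i; exact: UC.
have k0 : 0 < k.+1%:R :> R by rewrite ltr0n.
rewrite -(ler_pM2l k0); apply: le_trans (displacementM _ _ _) _.
have := UC ord_max; set V := U _ => VC.
set D := displacement (\prod_(_ < _) _)%g in IHk *.
have : k.+2%:R * D <= k.+2%:R * (k.+1%:R ^+ 2 * C) by rewrite ler_pM2l// ltr0n.
have : k.+1%:R * k.+2%:R * displacement V <= k.+1%:R * k.+2%:R * C.
  by rewrite ler_pM2l// mulr_gt0// ltr0n.
rewrite -(natr1 k.+1); lra.
Qed.

(** The orthogonal projection onto the line of v.  For v = 0 the convention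
    0^-1 = 0 gives the zero matrix, so that the reflection below is orthogonal
    for every v. *)
Definition line_proj (v : 'rV[R]_m) : 'M[R]_m :=
  ((v *m v^T) 0 0)^-1 *: (v^T *m v).

Lemma line_projM (v w : 'rV[R]_m) :
  v *m w^T = 0 -> line_proj v *m line_proj w = 0.
Proof.
move=> vw; rewrite /line_proj -scalemxAl -scalemxAr mulmxA -(mulmxA v^T).
by rewrite vw mulmx0 mul0mx !scaler0.
Qed.

Lemma rV_gram (v w : 'rV[R]_m) : v *m w^T = ((v *m w^T) 0 0)%:M.
Proof. by rewrite [LHS]mx11_scalar. Qed.

Lemma line_proj_idem (v : 'rV[R]_m) : line_proj v *m line_proj v = line_proj v.
Proof.
rewrite /line_proj -scalemxAl -scalemxAr mulmxA -(mulmxA v^T) {3}rV_gram.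
set s := (v *m v^T) 0 0; rewrite mul_mx_scalar -scalemxAl !scalerA.
have [->|s0] := eqVneq s 0; first by rewrite invr0 !mul0r !scale0r.
by congr (_ *: _); field.
Qed.

Lemma line_proj_tr (v : 'rV[R]_m) : (line_proj v)^T = line_proj v.
Proof. by rewrite /line_proj linearZ /= trmx_mul trmxK. Qed.

Lemma mxtrace_line_proj (v : 'rV[R]_m) : v != 0 -> \tr (line_proj v) = 1.
Proof.
move=> v0; rewrite /line_proj mxtraceZ mxtrace_mulC {2}rV_gram mxtrace_scalar.
rewrite mulr1n mulVf//; apply: contraNneq v0 => vv.
apply/eqP/rowP => j; rewrite mxE; move: vv; rewrite mxE.
move/psumr_eq0P => /(_ _ j isT); rewrite mxE => /(_ _)/eqP.
by rewrite mulf_eq0 orbb => vj; apply/eqP/vj => i _; rewrite mxE -expr2 sqr_ge0.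
Qed.

Lemma refl_mx_tr (v : 'rV[R]_m) :
  (1%:M - 2 *: line_proj v)^T = 1%:M - 2 *: line_proj v.
Proof. by rewrite linearB linearZ /= trmx1 line_proj_tr. Qed.

Fact refl_subproof (v : 'rV[R]_m) :
  (1%:M - 2 *: line_proj v) *m (1%:M - 2 *: line_proj v)^T == 1%:M.
Proof.
apply/eqP; rewrite refl_mx_tr.
rewrite mulmxBl !mulmxBr !mulmx1 !mul1mx -scalemxAl -scalemxAr line_proj_idem.
by apply/matrixP => i j; rewrite !mxE; ring.
Qed.

Definition refl v : orthogonal_mx := Orthogonal (refl_subproof v).

Lemma omat_refl v : omat (refl v) = 1%:M - 2 *: line_proj v.
Proof. by []. Qed.

Lemma reflK v : (refl v * refl v = 1)%g.
Proof.
apply: omat_inj; rewrite omatM omat1 -[RHS](eqP (refl_subproof v)).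
by rewrite refl_mx_tr.
Qed.

Lemma reflJ v (U : orthogonal_mx) : (refl v ^ U)%g = refl (v *m U).
Proof.
apply: omat_inj; rewrite conjgE !omatM omatV !omat_refl.
rewrite mulmxBl mul1mx mulmxBr omatKT -scalemxAl -scalemxAr /line_proj trmx_mul.
by rewrite -!scalemxAl -!scalemxAr !mulmxA -(mulmxA v) omatK mulmx1.
Qed.

Lemma refl_commute v w : v *m w^T = 0 -> commute (refl v) (refl w).
Proof.
move=> vw; have wv : w *m v^T = 0.
  by rewrite -[LHS]trmxK trmx_mul trmxK vw trmx0.
apply: omat_inj; rewrite !omatM !omat_refl.
move: (line_projM vw) (line_projM wv); move: (line_proj v) (line_proj w).
move=> P Q PQ QP; rewrite !mulmxBl !mulmxBr !mulmx1 !mul1mx.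
by rewrite -!scalemxAl -!scalemxAr PQ QP !scaler0 !subr0 addrAC.
Qed.

Lemma displacement_refl v : v != 0 -> displacement (refl v) = 2.
Proof.
move=> v0; rewrite /displacement omat_refl linearB /= mxtrace1 mxtraceZ.
by rewrite mxtrace_line_proj//; ring.
Qed.

(** A product of reflections in orthogonal vectors is 1 - 2P, where P is the
    projection onto their span, and tr P is their number. *)
Lemma displacement_prod_refl k (v : 'I_k -> 'rV[R]_m) :
  (forall i, v i != 0) -> (forall i j, i != j -> v i *m (v j)^T = 0) ->
  displacement (\prod_(i < k) refl (v i))%g = 2 * k%:R.
Proof.
move=> v0 vv; have -> : displacement (\prod_(i < k) refl (v i))%g =
    m%:R - \tr (1%:M - 2 *: \sum_(i < k) line_proj (v i)).
  congr (_ - \tr _); elim: k v vv {v0} => [|k IHk] v vv.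
    by rewrite !big_ord0 scaler0 subr0.
  rewrite !big_ord_recr omatM IHk => [|i j ij]; last first.
    by apply: vv; apply: contraNneq ij => /(congr1 val)/= ij; apply/eqP/val_inj.
  rewrite omat_refl; set P := \sum_(_ < _) _; set Q := line_proj _.
  have PQ : P *m Q = 0.
    rewrite mulmx_suml big1// => i _.
    by rewrite line_projM// vv// neq_ltn /= ltn_ord.
  move: P Q PQ => P Q PQ; rewrite mulmxBl !mulmxBr !mulmx1 !mul1mx.
  rewrite -!scalemxAl -!scalemxAr PQ !scaler0 subr0 scalerDr opprD addrA.
  by rewrite addrAC.
rewrite linearB /= mxtraceZ mxtrace1 linear_sum /=.
rewrite (eq_bigr (fun=> 1)) => [|i _]; last by rewrite mxtrace_line_proj.
by rewrite sumr_const card_ord; ring.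
Qed.

End OrthogonalGroup.

(** * A small rotation with an orthogonal orbit *)

Section Rotations.
Context (R : realType) (p : nat).

Definition cos_row (x : R) : 'rV[R]_p := \row_(j < p) cos (x * j%:R).
Definition sin_row (x : R) : 'rV[R]_p := \row_(j < p) sin (x * j%:R).

(** The direct sum of the plane rotations of angles 0, x, ..., (p - 1) x, with
    the first coordinates of all the planes listed before the second ones. *)
Definition rot_mx (x : R) : 'M[R]_(p + p) :=
  block_mx (diag_mx (cos_row x)) (diag_mx (sin_row x))
           (- diag_mx (sin_row x)) (diag_mx (cos_row x)).

Lemma rot_mxD x y : rot_mx (x + y) = rot_mx x *m rot_mx y.
Proof.
rewrite /rot_mx mulmx_block !mulNmx !mulmxN !mulmx_diag.
by congr block_mx; apply/matrixP => i j; rewrite !mxE mulrDl ?cosD ?sinD;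
  case: (i == j); rewrite ?mulr1n ?mulr0n; ring.
Qed.

Lemma rot_mxN x : rot_mx (- x) = (rot_mx x)^T.
Proof.
rewrite /rot_mx tr_block_mx linearN /= !tr_diag_mx.
by congr block_mx; apply/matrixP => i j;
  rewrite !mxE mulNr ?cosN ?sinN ?mulNrn ?opprK.
Qed.

Lemma rot_mx0 : rot_mx 0 = 1%:M.
Proof.
rewrite [RHS]scalar_mx_block; congr block_mx; apply/matrixP => i j;
  by rewrite !mxE mul0r ?cos0 ?sin0 ?mul0rn ?oppr0.
Qed.

Fact rot_subproof x : rot_mx x *m (rot_mx x)^T == 1%:M.
Proof. by rewrite -rot_mxN -rot_mxD subrr rot_mx0. Qed.

Definition rot x := Orthogonal (rot_subproof x).

Lemma rotX x k : (rot x ^+ k)%g = rot (k%:R * x).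
Proof.
elim: k => [|k IHk]; apply: omat_inj; first by rewrite expg0 mul0r /= rot_mx0.
by rewrite expgS IHk omatM /= -rot_mxD -natr1 addrC mulrDl mul1r.
Qed.

Lemma displacement_rot x :
  displacement (rot x) = 2 * \sum_(j < p) (1 - cos (x * j%:R)).
Proof.
rewrite /displacement /= /rot_mx mxtrace_block mxtrace_diag sumrB sumr_const.
rewrite card_ord (eq_bigr (fun j : 'I_p => cos (x * j%:R))) => [|j _].
  by rewrite natrD; ring.
by rewrite mxE.
Qed.

Definition cyclic_vector : 'rV[R]_(p + p) := row_mx (const_mx 1) 0.

Lemma cyclic_vector_rot x :
  cyclic_vector *m rot x = row_mx (cos_row x) (sin_row x).
Proof.
rewrite /cyclic_vector /= /rot_mx mul_row_block !mul0mx !addr0.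
by rewrite !mul_mx_diag; congr row_mx; apply/rowP => j; rewrite !mxE mul1r.
Qed.

Lemma cyclic_vector_gram x y :
  (cyclic_vector *m rot x) *m (cyclic_vector *m rot y)^T =
  (\sum_(j < p) cos ((x - y) * j%:R))%:M.
Proof.
rewrite !cyclic_vector_rot tr_row_mx mul_row_col.
apply/matrixP => i j; rewrite !ord1 !mxE -big_split /= mulr1n.
by apply: eq_bigr => k _; rewrite !mxE mulrBl cosB.
Qed.

(** The summands telescope: 2 sin (x / 2) cos (j x) is the difference of
    sin ((j + 1/2) x) and sin ((j - 1/2) x). *)
Lemma sin_half_sum_cos (x : R) :
  2 * sin (x / 2) * \sum_(j < p) cos (x * j%:R) =
  sin (x * p%:R - x / 2) + sin (x / 2).
Proof.
elim: p => [|q IHq].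
  by rewrite big_ord0 mulr0 mulr0 sub0r sinN addNr.
rewrite big_ord_recr /= mulrDr IHq.
have -> : x * q.+1%:R - x / 2 = x * q%:R + x / 2 by rewrite -natr1; field.
rewrite sinB sinD; ring.
Qed.

Lemma sinB_2pi (k : nat) (x : R) : sin (k%:R * (2 * pi) - x) = - sin x.
Proof.
rewrite addrC (_ : _ * _ = (pi *+ 2) *+ k) ?(periodicn (@sinD2pi R)) ?sinN//.
by rewrite -[RHS]mulr_natl -[pi *+ 2]mulr_natl.
Qed.

Lemma sum_cos_eq0 (k : nat) : (0 < k < p)%N ->
  \sum_(j < p) cos ((2 * pi * k%:R / p%:R) * j%:R) = 0 :> R.
Proof.
move=> /andP[k0 kp]; set x := 2 * pi * _ / _.
have p_gt0 := ltn_trans k0 kp.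
have p0 : 0 < p%:R :> R by rewrite ltr0n.
have sx0 : 0 < sin (x / 2).
  have -> : x / 2 = pi * (k%:R / p%:R) by rewrite /x; field; exact: lt0r_neq0.
  apply: sin_gt0_pi; rewrite mulr_gt0 ?pi_gt0 ?divr_gt0 ?ltr0n//=.
  by rewrite gtr_pMr ?pi_gt0// ltr_pdivrMr// mul1r ltr_nat.
have := sin_half_sum_cos x.
have -> : x * p%:R = k%:R * (2 * pi) by rewrite /x; field; exact: lt0r_neq0.
rewrite sinB_2pi addNr => /eqP; rewrite mulf_eq0 => /orP[|/eqP//].
by rewrite mulf_eq0 pnatr_eq0 (gt_eqF sx0).
Qed.

End Rotations.

(** Rotate the planes by the angles 2 pi j / (p n).  The n-th power rotates them
    by 2 pi j / p, and it moves the vector that is (1, 0) in every plane through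
    p orthogonal positions, because the cosines of the multiples of 2 pi k / p
    sum to 0.  The displacement of the rotation is
    2 \sum_j (1 - cos (2 pi j / (p n))), which tends to 0 as n grows while p
    stays fixed. *)
Lemma exists_small_shift (R : realType) (p : nat) : (0 < p)%N ->
  exists m (t : orthogonal_mx R m) (v : 'rV[R]_m) (n : nat),
  [/\ displacement t <= 1, v != 0 &
    forall i j, (i < p)%N -> (j < p)%N -> i != j ->
      (v *m (t ^+ n ^+ i)%g) *m (v *m (t ^+ n ^+ j)%g)^T = 0].
Proof.
move=> p0; have p0' : 0 < p%:R :> R by rewrite ltr0n.
have [e /= e0 cose] : exists2 e : R, 0 < e &
    forall x : R, `|x| < e -> 1 - cos x <= (2 * p%:R)^-1.
  have /cvgrPdist_le /(_ (2 * p%:R)^-1) := @continuous_cos R 0.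
  rewrite invr_gt0 mulr_gt0// => /(_ isT)/nbhs_ballP[e /= e0 ecos].
  exists e => // x xe; apply: le_trans (ler_norm _) _.
  by rewrite -{1}cos0; apply: ecos; rewrite -ball_normE /= sub0r normrN.
have pi0 : 0 < pi :> R := pi_gt0 R.
pose n := (Num.truncn (2 * pi / e)).+1.
have ne : 2 * pi / e < n%:R by rewrite truncnS_gt.
have n0 : 0 < n%:R :> R by rewrite ltr0n.
pose d : R := 2 * pi / (p%:R * n%:R).
exists (p + p)%N, (rot p d), (cyclic_vector R p), n; split.
- rewrite displacement_rot -ler_pdivlMl// mulr1.
  apply: (@le_trans _ _ (\sum_(j < p) (2 * p%:R)^-1)).
    apply: ler_sum => j _; apply: cose; rewrite ger0_norm; last first.
      by rewrite mulr_ge0 ?divr_ge0 ?mulr_ge0 ?ler0n ?pi_ge0.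
    apply: (@le_lt_trans _ _ (2 * pi / n%:R)); last first.
      by move: ne; rewrite !ltr_pdivrMr// [e * _]mulrC.
    have -> : d * j%:R = 2 * pi / n%:R * (j%:R / p%:R).
      by rewrite /d; field; rewrite !pnatr_eq0 -!lt0n p0.
    rewrite ger_pMr ?divr_gt0 ?mulr_gt0// ler_pdivrMr// mul1r ler_nat.
    exact: ltnW.
  rewrite sumr_const card_ord -[_ *+ p]mulr_natl le_eqVlt; apply/orP; left.
  by apply/eqP; field; rewrite pnatr_eq0 -lt0n.
- apply/eqP => v0; have := cyclic_vector_gram p (0 : R) 0.
  rewrite v0 !mul0mx => /matrixP/(_ 0 0); rewrite !mxE mulr1n.
  under eq_bigr do rewrite subr0 mul0r cos0.
  by rewrite sumr_const card_ord => /esym/eqP; rewrite pnatr_eq0 gtn_eqF.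
- move=> i j; wlog ij : i j / (j < i)%N => [hw ip jp|ip _ _].
    rewrite neq_ltn => /orP[ij|ji]; last by apply: hw => //; rewrite gtn_eqF.
    rewrite -[LHS]trmxK trmx_mul trmxK hw ?trmx0// gtn_eqF//.
  rewrite -!expgnA !rotX cyclic_vector_gram.
  have -> : (n * i)%:R * d - (n * j)%:R * d = 2 * pi * (i - j)%:R / p%:R.
    rewrite natrB ?(ltnW ij)// !natrM /d; field.
    by rewrite !pnatr_eq0 -!lt0n p0.
  rewrite sum_cos_eq0 ?subn_gt0 ?ij ?(leq_ltn_trans (leq_subr _ _))//.
  by rewrite -diag_const_mx; apply/matrixP => a b; rewrite !mxE mul0rn.
Qed.

(** * Pushing a hole through the crosscap *)

Section Pushing.
Local Open Scope group_scope.
Context (G : groupType) (a b : G) (n : nat).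

(** A state (g, x) stands for the solution g^2 = x z (a b)^-1, where z is
    determined by x z = c = g^2 a b.  Twisting conjugates x and z by c^n, which
    preserves their product c; moving the conjugate y of x through the crosscap
    then turns g into y^-1 g and y into a conjugate of y^-1. *)
Definition push (s : G * G) : G * G :=
  let y := s.2 ^ (s.1 * s.1 * (a * b)) ^+ n in
  let g := y^-1 * s.1 in (g, y^-1 ^ g^-1).

(** The process starts from the solution 1^2 = a b (a b)^-1. *)
Definition pushes (k : nat) : G * G := iter k push (1, a).

(** The second factor z = x^-1 c of the state is only conjugated by a push. *)
Lemma push_square (s : G * G) :
  let c := s.1 * s.1 * (a * b) in
  (push s).2^-1 * ((push s).1 * (push s).1 * (a * b)) = (s.2^-1 * c) ^ c ^+ n.
Proof.
case: s => g x /=; set c := g * g * (a * b); set y := x ^ c ^+ n.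
have -> : (x^-1 * c) ^ c ^+ n = y^-1 * c.
  by rewrite conjMg conjVg -/y (conjg_fixP (introT eqP (commgXg c n))).
rewrite /c; move: y => {x c}y; rewrite conjVg invgK conjgE invgK !mulgA.
by rewrite invgM invgK !mulgA !(mulgK, mulgVK).
Qed.

(** As long as g is an involution, c = g^2 a b equals a b, so conjugation by c^n
    takes r_k to r_{k+1}; g is then multiplied by r_{k+1}, and
    stays an involution because the r_i commute. *)
Lemma pushes_commuting_involutions (r : nat -> G) (K : nat) :
  (forall i, r i * r i = 1) ->
  (forall i j, (i <= K)%N -> (j <= K)%N -> commute (r i) (r j)) ->
  (forall i, r i ^ (a * b) ^+ n = r i.+1) -> r 0%N = a ->
  forall k, (k <= K)%N -> pushes k = (\prod_(i < k) r i.+1, r k).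
Proof.
move=> rK rC rJ r0 k kK.
suff [] : pushes k = (\prod_(i < k) r i.+1, r k) /\
    (\prod_(i < k) r i.+1) * (\prod_(i < k) r i.+1) = 1 by [].
elim: k kK => [|k IHk] kK; first by rewrite big_ord0 mulg1 r0.
have [pk gg] := IHk (ltnW kK).
set g := \prod_(i < k) r i.+1 in pk gg *.
have rg : commute (r k.+1) g.
  apply: commute_prod => i _; apply: rC => //; apply: leq_trans kK.
  by rewrite ltnS ltnW.
have rV : (r k.+1)^-1 = r k.+1 by apply: mulg1_eq.
rewrite big_ord_recr /= -/g -rg; split; last first.
  by rewrite mulgA -(mulgA (r k.+1)) -rg mulgA rK mul1g gg.
rewrite -/(pushes k) pk /push /= gg mul1g rJ rV; congr (_, _).
have com : commute (r k.+1) (r k.+1 * g)^-1 by apply/commuteV/commuteM.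
by rewrite conjgE com mulKg.
Qed.

End Pushing.

Lemma gmulf_pushes (G H : groupType) (phi : UMagmaMorphism.type G H)
    (a b : G) (n k : nat) :
  pushes (phi a) (phi b) n k =
  (phi (pushes a b n k).1, phi (pushes a b n k).2).
Proof.
elim: k => [|k IHk]; first by rewrite /pushes /= gmulf1.
rewrite -/(push _ _ _ _) /= -!/(pushes _ _ _ k) IHk /push /=.
by rewrite !(gmulfV, gmulfM, gmulfJ, gmulfXn).
Qed.

(** * Bounds for the word norm *)

Section WordNorm.
Context (F : groupType) (S : set F) (freeS : freely_generated S).
Local Notation norm := (word_norm freeS).

Lemma conj_gens_gen s : S s -> conj_gens S s.
Proof.
by move=> Ss; apply/conj_gensP; exists s, 1%g; split=> //; left; rewrite conjg1.
Qed.

Lemma word_norm_conj_gens h : conj_gens S h -> (norm h <= 1)%N.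
Proof. by move=> Sh; apply/word_norm_le/is_word_product1. Qed.

Lemma word_norm1 : norm 1%g = 0%N.
Proof. by apply/eqP; rewrite word_norm_eq0. Qed.

(** The factors x and z in g^2 = x z (a b)^-1 stay conjugate to generators or
    their inverses, which keeps the norm of g^2 at most 4. *)
Lemma pushes_conj_gens a b n k : S a -> S b ->
  let s := pushes a b n k in
  conj_gens S s.2 /\ conj_gens S (s.2^-1 * (s.1 * s.1 * (a * b)))%g.
Proof.
move=> Sa Sb; elim: k => [|k [Sx Sxc]].
  by rewrite /= !mul1g mulKg; split; apply: conj_gens_gen.
rewrite /pushes iterS -/(pushes a b n k) push_square; split.
  by apply/conj_gensJ/conj_gensV/conj_gensJ.
exact: conj_gensJ.
Qed.

Lemma word_norm_pushes_square a b n k : S a -> S b ->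
  (norm ((pushes a b n k).1 * (pushes a b n k).1)%g <= 4)%N.
Proof.
move=> Sa Sb; have [] := pushes_conj_gens n k Sa Sb.
case: (pushes a b n k) => g x /= Sx Sxc.
have -> : (g * g = x * (x^-1 * (g * g * (a * b))) * (a * b)^-1)%g.
  by rewrite mulVKg mulgK.
apply: leq_trans (word_normM _ _ _) _; rewrite -[4%N]/((1 + 1) + (1 + 1))%N.
apply: leq_add.
  apply: leq_trans (word_normM _ _ _) _.
  by apply: leq_add; apply: word_norm_conj_gens.
rewrite word_normV; apply: leq_trans (word_normM _ _ _) _.
by apply: leq_add; apply/word_norm_conj_gens/conj_gens_gen.
Qed.

Lemma word_norm_pushesS a b n k : S a -> S b ->
  (norm (pushes a b n k.+1).1 <= (norm (pushes a b n k).1).+1)%N.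
Proof.
move=> Sa Sb; have [Sx _] := pushes_conj_gens n k Sa Sb.
rewrite /pushes iterS -/(pushes a b n k) /=.
apply: leq_trans (word_normM _ _ _) _; rewrite -add1n leq_add2r.
by rewrite word_normV word_normJ word_norm_conj_gens.
Qed.

(** The displacement is the same for an element, its inverse and its conjugates,
    so a bound on the generators holds for every factor of a product of length
    norm g. *)
Lemma displacement_word_norm (R : realFieldType) (m : nat) (C : R)
    (phi : UMagmaMorphism.type F (orthogonal_mx R m)) (g : F) :
  (forall s, S s -> displacement (phi s) <= C) ->
  displacement (phi g) <= (norm g)%:R ^+ 2 * C.
Proof.
move=> SC; have /asboolP[t St {1}->] := word_norm_product freeS g.
rewrite gmulf_prod; apply: displacement_prod => i.
have /conj_gensP[s [h [Ss []->]]] := St i.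
  by rewrite gmulfJ displacementJ SC.
by rewrite gmulfJ gmulfV displacementJ displacementV SC.
Qed.

(** If s is the only generator, conjugation by s agrees with the identity on the
    generators, hence everywhere, so s is central; then conjugation by any
    element fixes the generators, hence is the identity too. *)
Lemma free_gens_eq_abelian : (forall s t, S s -> S t -> s = t) ->
  forall x y : F, commute x y.
Proof.
move=> SS.
have conjM (h : F) : {morph (fun g : F => g ^ h)%g : x y / (x * y)%g}.
  by move=> x y; rewrite conjMg.
pose conj h : {multiplicative F -> F} := HB.pack (fun g : F => g ^ h)%g
  (isMultiplicative.Build F F _ (conjM h)).
have [_ uniqF] := freeS (fun s : S => val s).
have central (h : F) : (forall s, S s -> commute s h) -> forall x, commute x h.
  move=> Sh x; apply/commgP; rewrite -conjg_fix; apply/eqP.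
  apply: (uniqF (conj h) idfun) => s /=; apply/conjg_fixP/commgP/Sh.
  exact: set_valP.
move=> x y; apply: (central y) => s Ss; apply: commute_sym.
by apply: (central s) => t St; rewrite (SS s t Ss St).
Qed.

Lemma exists_distinct_gens : ~ (forall x y : F, commute x y) ->
  exists a b, [/\ S a, S b & a != b].
Proof.
move=> nab; apply: contrapT => nSS; apply/nab/free_gens_eq_abelian => s t Ss St.
by apply: contrapT => /eqP st; apply: nSS; exists s, t.
Qed.

Lemma free_representation (H : groupType) (a b : F) (A B : H) :
  S a -> S b -> a != b ->
  exists phi : UMagmaMorphism.type F H, [/\ phi a = A, phi b = B &
    forall s, S s -> s != a -> s != b -> phi s = 1%g].
Proof.
move=> Sa Sb ab; pose f (s : S) : H :=
  if val s == a then A else if val s == b then B else 1%g.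
have [[phi phiS] _] := freeS f.
have phiE s : S s -> phi s = if s == a then A else if s == b then B else 1%g.
  move=> Ss; pose s' : S := SigSub (mem_set Ss).
  by rewrite -[s in LHS]/(val s') phiS /f.
(* The universal property only provides a map preserving products. *)
have phi1 : phi 1%g = 1%g.
  by apply: (mulgI (phi 1%g)); rewrite -gmulfM !mulg1.
pose phi' : UMagmaMorphism.type F H := HB.pack (phi : F -> H)
  (isMultiplicative.Build F H phi gmulfM)
  (Multiplicative_isUMagmaMorphism.Build F H phi phi1).
exists phi'; split => [||s Ss /negPf sa /negPf sb];
  rewrite phiE ?eqxx ?sa ?sb//.
by rewrite eq_sym (negPf ab).
Qed.

Lemma nat_ivt (f : nat -> nat) (N K : nat) :
  f 0%N = 0%N -> (forall k, (f k.+1 <= (f k).+1)%N) -> (N <= f K)%N ->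
  exists k, f k = N.
Proof.
move=> f0 fS; elim: K => [|K IHK].
  by rewrite f0 leqn0 => /eqP->; exists 0%N.
rewrite leq_eqVlt => /orP[/eqP->|NfK]; first by exists K.+1.
by apply: IHK; rewrite -ltnS (leq_trans NfK)// fS.
Qed.

(** Sending a to a reflection and a b to a small rotation, the displacement of
    the K-th element is 2 K, and at most 6 times the square of its norm. *)
Lemma exists_large_pushes (R : realType) a b N : S a -> S b -> a != b ->
  exists n K, (N <= norm (pushes a b n K).1)%N.
Proof.
move=> Sa Sb ab.
(* Then 2 K <= 6 (norm g)^2 becomes N^2 <= (norm g)^2. *)
pose K := (3 * N ^ 2)%N.
have [m [t [v [n [t1 v0 vv]]]]] := @exists_small_shift R K.+1 isT.
pose r i := refl (v *m (t ^+ n ^+ i)%g).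
have rJ i : (r i ^ t ^+ n = r i.+1)%g.
  by rewrite /r reflJ -mulmxA -omatM -expgSr.
have tv0 (U : orthogonal_mx R m) : v *m U != 0.
  apply: contra v0 => /eqP vU; rewrite -(mulmx1 v) -(omatK U) mulmxA vU.
  by rewrite mul0mx.
have [phi [phia phib phi1]] :=
  free_representation (r 0%N) ((r 0%N)^-1 * t)%g Sa Sb ab.
have phiab : (phi a * phi b)%g = t by rewrite phia phib mulVKg.
have phiS s : S s -> displacement (phi s) <= 6.
  move=> Ss; have [->|sa] := eqVneq s a.
    by rewrite phia displacement_refl// ler_nat.
  have [->|sb] := eqVneq s b.
    (* b = a^-1 (a b) is a product of displacements 2 and at most 1, and
       2 * 2 + 2 * 1 = 6. *)
    rewrite phib; have := displacementM 1 (r 0%N)^-1%g t.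
    by rewrite displacementV displacement_refl//; move: t1; lra.
  by rewrite phi1// -(expg0 t) expg0 /displacement omat1 mxtrace1 subrr.
exists n, K.
have rC i j : (i <= K)%N -> (j <= K)%N -> commute (r i) (r j).
  move=> iK jK; have [->|ij] := eqVneq i j; first exact: commute_refl.
  by apply: refl_commute; apply: vv.
have phig : phi (pushes a b n K).1 = (\prod_(i < K) r i.+1)%g.
  have rJ' i : (r i ^ (phi a * phi b) ^+ n = r i.+1)%g by rewrite phiab rJ.
  have := pushes_commuting_involutions (fun i => reflK _) rC rJ' (esym phia).
  by move=> /(_ K (leqnn K)); rewrite gmulf_pushes => -[].
have := displacement_word_norm (pushes a b n K).1 phiS.
rewrite phig displacement_prod_refl => [|i|i j ij]; last 2 first.
- exact: tv0.
- by apply: vv; rewrite ?ltnS// ltn_ord.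
rewrite -natrX -!natrM ler_nat /K mulnA mulnC leq_pmul2r//.
by rewrite leq_exp2r.
Qed.

Lemma exists_norm_small_square (R : realType) :
  ~ (forall x y : F, commute x y) ->
  forall N, exists2 g, norm g = N & (norm (g * g)%g <= 4)%N.
Proof.
move=> /exists_distinct_gens[a [b [Sa Sb ab]]] N.
have [n [K NK]] := exists_large_pushes R N Sa Sb ab.
have [//|k|k kN] := @nat_ivt (fun k => norm (pushes a b n k).1) N K _ _ NK.
- by rewrite word_norm1.
- exact: word_norm_pushesS.
exists (pushes a b n k).1 => //; exact: word_norm_pushes_square.
Qed.

End WordNorm.

(** * From norms to the asymptotic cone *)

Section AsymptoticCone.
Context (w : set_system posint) (Uw : UltraFilter w).
Context (nonprincipal : forall n : posint, w <> principal_filter n).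

Lemma nonprincipal_setC1 (n : posint) : w (~` [set n]).
Proof.
have [wn|//] := in_ultra_setVsetC [set n] Uw.
case: (@nonprincipal n); apply/seteqP; split => A.
  move=> wA; apply/principal_filterP.
  have /filter_ex[m [/= -> //]] : w ([set n] `&` A) by exact: filterI.
by move/principal_filterP => An; apply: filterS wn => _ ->.
Qed.

Lemma nonprincipal_gt (N : nat) : w [set n : posint | (N < val n)%N].
Proof.
elim: N => [|N IHN]; first by apply: filterE => n; exact: valP.
have wN1 := nonprincipal_setC1 (exist _ N.+1 isT).
apply: filterS2 IHN wN1 => n /= Nn nN1; rewrite ltn_neqAle Nn andbT.
by apply/eqP => Nn'; apply: nN1; exact: val_inj.
Qed.

Lemma ultralim_bounded_div (R : realType) (f : posint -> nat) (C : nat) :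
  (forall n, (f n <= C)%N) ->
  lim (((f n)%:R / (val n)%:R : R) @[n --> w]) = 0.
Proof.
move=> fC; apply/cvg_lim => //; apply/cvgrPdist_le => /= e e0.
have := nonprincipal_gt (Num.truncn (C%:R / e)).
apply: filterS => n /= Cn; rewrite sub0r normrN ger0_norm ?divr_ge0//.
rewrite ler_pdivrMr ?ltr0n ?(valP n)// mulrC -ler_pdivrMr//.
apply: (@le_trans _ _ (C%:R / e)).
  by rewrite ler_pM2r ?invr_gt0// ler_nat.
by apply/ltW; apply: lt_le_trans (truncnS_gt _) _; rewrite ler_nat.
Qed.

Context (R : realType) (F : groupType) (S : set F) (freeS : freely_generated S).

Lemma exists_cone_involution (g : posint -> F) (C : nat) :
  (forall n, word_norm freeS (g n) = val n) ->
  (forall n, (word_norm freeS (g n * g n)%g <= C)%N) ->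
  exists x : Cone Uw (word_metric_group freeS R), x <> 1%g /\ (x * x)%g = 1%g.
Proof.
move=> gn gC; pose X := word_metric_group freeS R.
have dist1 (h : X) : mdist h 1%g = (word_norm freeS h)%:R :> R.
  by rewrite /mdist /= /word_dist mulg1 word_normV.
have g_growth : `[< linear_growth (g : posint -> X) >].
  apply/asboolP; exists (1 + mdist (1%g : X) (g posint1)) => n.
  have n0 : 0 < (val n)%:R :> R by rewrite ltr0n (valP n).
  rewrite ler_pdivrMr// (le_trans (metric_triangle _ (1%g : X) _))//.
  rewrite dist1 gn mulrDl mul1r lerD2l ler_peMr ?mdist_ge0// ler1n.
  exact: (valP n).
pose x := ConeSeq g_growth.
exists (cone_class Uw x); split.
  move/cone_classE; rewrite /cone_pdist /=.
  under eq_fun => n do rewrite dist1 gn.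
  rewrite (_ : (fun n => _) = cst 1) ?lim_cst// => [/eqP|].
    by rewrite oner_eq0.
  by apply/funext => n /=; rewrite divff// gt_eqF// ltr0n (valP n).
transitivity (coneM (cone_class Uw x) (cone_class Uw x)) => //.
rewrite coneM_class; apply/cone_classE; rewrite /cone_pdist /=.
under eq_fun => n do rewrite dist1.
exact: ultralim_bounded_div.
Qed.

End AsymptoticCone.

Theorem theorem1p1 (R : realType) (F : groupType) (S : set F)
    (freeS : freely_generated S)
    (nonabelianF : ~ (forall x y : F, commute x y))
    (w : set_system posint) (Uw : UltraFilter w)
    (nonprincipal : forall n : posint, w <> principal_filter n) :
  exists x : Cone Uw (word_metric_group freeS R),
    x <> 1%g /\ (x * x)%g = 1%g.
Proof.
have /choice[g gP] : forall n : posint, exists g,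
    word_norm freeS g = val n /\ (word_norm freeS (g * g)%g <= 4)%N.
  move=> n.
  have [g gn g4] := exists_norm_small_square freeS R nonabelianF (val n).
  by exists g.
apply: (@exists_cone_involution w Uw nonprincipal R F S freeS g 4) => n;
  by have [] := gP n.
Qed.
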